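(* Assume that the standing assumptions (A1)--(A5) on $(f_0,f_1,\phi_0,\phi_1)$ hold, and let $\{x_k\}$ be the sequence of iterates generated by the inexact trust-region algorithm (both described in the context). If $$\sum_{k=1}^\infty \Big(1+\max_{j=1,\ldots,k}\|B_j\|_{\mathcal{L}(X)}\Big)^{-1} = +\infty,$$ then $$\liminf_{k\to\infty}\, h_k = 0.$$ In addition, if there exists $t_{\max}>0$ satisfying $t_k\le t_{\max}$ for all $k$, then $$\liminf_{k\to\infty}\, H_k(t) = 0\qquad\text{for all } t>0.$$
   Context: $X,Y$ are real Hilbert spaces; $\mathcal{L}(X,Y)$ is the space of bounded linear operators with the operator norm, $\mathcal{L}(X)=\mathcal{L}(X,X)$. For a proper closed convex $\psi:X\to(-\infty,+\infty]$, $\mathrm{dom}\,\psi=\{x:\psi(x)<+\infty\}$ and $\mathrm{prox}_{\psi}(x)=\arg\min_{x'\in X}\{\frac12\|x'-x\|_X^2+\psi(x')\}$. Problem: minimize $J(x)=f_0(x)+\phi_1(f_1(x))+\phi_0(x)$ over $x\in X$. Standing assumptions: (A1) $\phi_0:X\to(-\infty,+\infty]$ is proper, closed and convex. (A2) $f_0:X\to\mathbb{R}$, and there is an open set $U\supseteq\mathrm{dom}\,\phi_0$ on which $f_0$ is Fréchet differentiable with $\nabla f_0$ Lipschitz continuous with modulus $M_{f_0}>0$. (A3) $\phi_1:Y\to\mathbb{R}$ is convex and Lipschitz continuous with modulus $M_{\phi_1}>0$. (A4) $f_1:X\to Y$, and there is an open set $V\supseteq\mathrm{dom}\,\phi_0$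 on which $f_1$ is Fréchet differentiable with $f_1'$ Lipschitz continuous with modulus $M_{f_1}>0$. (A5) $J$ is bounded from below by some $\kappa_{\rm lb}\in\mathbb{R}$. Inexact trust-region algorithm. Inputs: $x_1\in\mathrm{dom}\,\phi_0$, $\Delta_1>0$, $0<\eta_1<\eta_2<1$, $0<\gamma_1\le\gamma_2<1\le\gamma_3$. Fixed constants independent of $k$: $\kappa_{\rm rad},\kappa_{\rm fcd},\kappa_{\rm grad},\kappa_{\rm val},\kappa_{\rm jac},\kappa_{\rm obj}>0$, $\zeta>1$, $0<\eta<\min\{\eta_1,1-\eta_2\}$, and positive reals $\zeta_k$ with $\zeta_k\to0$. For $k=1,2,\ldots$: (1) Choose $g_k\in X$, $b_k\in Y$, $A_k\in\mathcal{L}(X,Y)$, $B_k\in\mathcal{L}(X)$, $t_k>0$. Put $q_k(x)=\frac12(B_k(x-x_k),x-x_k)_X+(g_k,x-x_k)_X$, $\ell_k(x)=A_k(x-x_k)+b_k$, $\psi_k(x)=\phi_1(\ell_k(x))+\phi_0(x)$, $m_k=q_k+\psi_k$, $H_k(t)=\frac1t\|\mathrm{prox}_{t\psi_k}(x_k-tg_k)-x_k\|_X$ for $t>0$, and $h_k=H_k(t_k)$. The choices must satisfy $\|g_k-\nabla f_0(x_k)\|_X\le\kappa_{\rm grad}\min\{h_k,\Delta_k\}$, $\|b_k-f_1(x_k)\|_Y\le\kappa_{\rm val}\min\{h_k,\Delta_k^2\}$, $\|A_k-f_1'(x_k)\|_{\mathcal{L}(X,Y)}\le\kappa_{\rm jac}\min\{h_k,\Delta_k\}$.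 (2) Compute a trial iterate $x_k^+\in X$ with $\|x_k^+-x_k\|_X\le\kappa_{\rm rad}\Delta_k$ and $m_k(x_k)-m_k(x_k^+)\ge\kappa_{\rm fcd}h_k\min\{h_k/(1+\|B_k\|_{\mathcal{L}(X)}),\Delta_k\}$ (in particular $x_k^+\in\mathrm{dom}\,\phi_0$). (3) Let $\mathrm{ared}_k=J(x_k)-J(x_k^+)$, $\mathrm{pred}_k=m_k(x_k)-m_k(x_k^+)$, and let $\mathrm{cred}_k\in\mathbb{R}$ satisfy $|\mathrm{ared}_k-\mathrm{cred}_k|\le\kappa_{\rm obj}[\eta\min\{\mathrm{pred}_k,\zeta_k\}]^{\zeta}$. Set $\rho_k=\mathrm{cred}_k/\mathrm{pred}_k$. (4) If $\rho_k<\eta_1$: $x_{k+1}=x_k$ and $\Delta_{k+1}\in[\gamma_1\Delta_k,\gamma_2\Delta_k]$. Otherwise $x_{k+1}=x_k^+$, with $\Delta_{k+1}\in[\gamma_2\Delta_k,\Delta_k]$ if $\rho_k\in[\eta_1,\eta_2)$ and $\Delta_{k+1}\in[\Delta_k,\gamma_3\Delta_k]$ if $\rho_k\ge\eta_2$. The algorithm is understood to run indefinitely with all ratios $\rho_k$ well defined. Proximity operators are computed exactly. *)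

(* Defs.v *)
From HB Require Import structures.
From mathcomp Require Import all_boot all_order all_algebra.
From mathcomp Require Import all_classical all_reals all_analysis.

Set Implicit Arguments.
Unset Strict Implicit.
Unset Printing Implicit Defensive.

Import Order.TTheory GRing.Theory Num.Theory.
Import numFieldNormedType.Exports.

Local Open Scope classical_set_scope.
Local Open Scope ring_scope.

HB.mixin Record CompleteNormedModule_isHilbert (R : realType) X
    of CompleteNormedModule R X := {
  inner : X -> X -> R ;
  innerC : forall u v : X, inner u v = inner v u ;
  innerDl : forall u v w : X, inner (u + v) w = inner u w + inner v w ;
  innerZl : forall (a : R) (u v : X), inner (a *: u) v = a * inner u v ;
  inner_norm : forall u : X, inner u u = `|u| ^+ 2
}.

#[short(type="hilbertType")]
HB.structure Definition Hilbert (R : realType) :=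
  {X of CompleteNormedModule_isHilbert R X & CompleteNormedModule R X}.

Section functional_analysis.
Context {R : realType}.

(* Only meaningful when [f] is bounded on the unit ball: [sup] of an unbounded
   set is [0]. *)
Definition opnorm (V W : normedModType R) (f : V -> W) : R :=
  sup [set `|f v| | v in [set v : V | `|v| <= 1]].

(* The Riesz representative of the Fréchet differential. *)
Definition grad (X : hilbertType R) (f : X -> R) (x : X) : X :=
  xget 0 [set g : X | forall v : X, 'd (f : X -> R^o) x v = inner g v].

Definition dom (T : Type) (psi : T -> \bar R) : set T :=
  [set x | (psi x < +oo)%E].

(* The first conjunct says that [psi] takes its values in ]-oo, +oo]. *)
Definition proper (T : Type) (psi : T -> \bar R) : Prop :=
  (forall x, psi x != -oo%E) /\ dom psi !=set0.

(* Closed epigraph. *)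
Definition closed_function (V : normedModType R) (psi : V -> \bar R) : Prop :=
  closed [set p : V * R | (psi p.1 <= p.2%:E)%E].

(* Intended for [psi] with values in ]-oo, +oo]; at [t = 0] and [t = 1] it is
   harmless because [0 * +oo = 0]. *)
Definition convex_efunction (V : normedModType R) (psi : V -> \bar R) : Prop :=
  forall (x y : V) (t : R), 0 <= t <= 1 ->
    (psi (t *: x + (1 - t) *: y)%R
       <= t%:E * psi x + (1 - t)%:E * psi y)%E.

(* A minimizer; it exists and is unique when [psi] is proper, closed and
   convex. *)
Definition prox (X : hilbertType R) (psi : X -> \bar R) (x : X) : X :=
  xget 0 [set z : X | forall y : X,
    ((2^-1 * `|z - x| ^+ 2)%:E + psi z
       <= (2^-1 * `|y - x| ^+ 2)%:E + psi y)%E].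

End functional_analysis.

Section problem.
Context {R : realType} {X Y : hilbertType R}.
Variables (f0 : X -> R) (f1 : X -> Y) (phi0 : X -> \bar R) (phi1 : Y -> R).

Definition objective (x : X) : \bar R :=
  ((f0 x + phi1 (f1 x))%:E + phi0 x)%E.

Record standing_assumptions : Prop := {
  phi0_proper : proper phi0 ;
  phi0_closed : closed_function phi0 ;
  phi0_convex : convex_efunction phi0 ;
  f0_smooth : exists (U : set X) (M : R),
    [/\ open U, dom phi0 `<=` U, 0 < M,
        forall x, U x -> differentiable (f0 : X -> R^o) x &
        M.-lipschitz_U (grad f0)] ;
  phi1_convex : convex_function [set: Y] phi1 ;
  phi1_lipschitz : exists2 M : R, 0 < M & M.-lipschitz (phi1 : Y -> R^o) ;
  f1_smooth : exists (V : set X) (M : R),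
    [/\ open V, dom phi0 `<=` V, 0 < M,
        forall x, V x -> differentiable f1 x &
        forall x y, V x -> V y ->
          opnorm ('d f1 x \- 'd f1 y) <= M * `|x - y|] ;
  objective_lbound : exists klb : R, forall x, (klb%:E <= objective x)%E
}.

End problem.

Record tr_params (R : realType) := {
  eta1 : R ; eta2 : R ;
  gamma1 : R ; gamma2 : R ; gamma3 : R ;
  krad : R ; kfcd : R ; kgrad : R ; kval : R ; kjac : R ; kobj : R ;
  zeta : R ; eta : R
}.

Record tr_params_ok (R : realType) (p : tr_params R) : Prop := {
  eta12_ok : 0 < eta1 p /\ eta1 p < eta2 p < 1 ;
  gamma_ok : [/\ 0 < gamma1 p, gamma1 p <= gamma2 p, gamma2 p < 1 &
                 1 <= gamma3 p] ;
  kappa_ok : [/\ 0 < krad p, 0 < kfcd p & 0 < kgrad p] /\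
             [/\ 0 < kval p, 0 < kjac p & 0 < kobj p] ;
  zeta_ok : 1 < zeta p ;
  eta_ok : 0 < eta p < Num.min (eta1 p) (1 - eta2 p)
}.

(* All sequences are indexed from 0: the term of index [k] belongs to the
   iteration numbered [k + 1] in 1-based numbering. *)
Record tr_run (R : realType) (X Y : hilbertType R) := {
  iterate : nat -> X ;                (* x_k *)
  trial : nat -> X ;                  (* x_k^+ *)
  radius : nat -> R ;                 (* Delta_k *)
  model_grad : nat -> X ;             (* g_k *)
  model_val : nat -> Y ;              (* b_k *)
  model_jac : nat -> {linear X -> Y} ; (* A_k *)
  model_hess : nat -> {linear X -> X} ; (* B_k *)
  prox_step : nat -> R ;              (* t_k *)
  cred : nat -> R ;
  obj_tol : nat -> R                  (* zeta_k *)
}.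

Section algorithm.
Context {R : realType} {X Y : hilbertType R}.
Variables (f0 : X -> R) (f1 : X -> Y) (phi0 : X -> \bar R) (phi1 : Y -> R).
Variables (p : tr_params R) (s : tr_run X Y).

Definition quad_model (k : nat) (x : X) : R :=
  2^-1 * inner (model_hess s k (x - iterate s k)) (x - iterate s k)
  + inner (model_grad s k) (x - iterate s k).

Definition lin_model (k : nat) (x : X) : Y :=
  model_jac s k (x - iterate s k) + model_val s k.

Definition nonsmooth_model (k : nat) (x : X) : \bar R :=
  ((phi1 (lin_model k x))%:E + phi0 x)%E.

Definition model (k : nat) (x : X) : \bar R :=
  ((quad_model k x)%:E + nonsmooth_model k x)%E.

Definition stationarity (k : nat) (t : R) : R :=
  t^-1 * `| prox (fun x => (t%:E * nonsmooth_model k x)%E)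
                 (iterate s k - t *: model_grad s k)
            - iterate s k |.

Definition h_k (k : nat) : R := stationarity k (prox_step s k).

(* [fine] loses nothing in [ared_k] and [pred_k]: along a run [iterate s k] and
   [trial s k] both lie in [dom phi0] (for the latter, this follows from
   [sufficient_decrease], whose left-hand side would otherwise be [-oo]). *)
Definition ared_k (k : nat) : R :=
  fine (objective f0 f1 phi0 phi1 (iterate s k)
        - objective f0 f1 phi0 phi1 (trial s k))%E.

Definition pred_k (k : nat) : R :=
  fine (model k (iterate s k) - model k (trial s k))%E.

Definition ratio (k : nat) : R := cred s k / pred_k k.

Record generated_by_algorithm : Prop := {
  initial_iterate : dom phi0 (iterate s 0) ;
  initial_radius : 0 < radius s 0 ;
  obj_tol_gt0 : forall k, 0 < obj_tol s k ;
  obj_tol_cvg0 : obj_tol s @ \oo --> (0 : R) ;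
  model_jac_bounded : forall k, bounded_fun_norm (model_jac s k) ;
  model_hess_bounded : forall k, bounded_fun_norm (model_hess s k) ;
  prox_step_gt0 : forall k, 0 < prox_step s k ;
  model_grad_accuracy : forall k,
    `|model_grad s k - grad f0 (iterate s k)|
      <= kgrad p * Num.min (h_k k) (radius s k) ;
  model_val_accuracy : forall k,
    `|model_val s k - f1 (iterate s k)|
      <= kval p * Num.min (h_k k) (radius s k ^+ 2) ;
  model_jac_accuracy : forall k,
    opnorm (model_jac s k \- 'd f1 (iterate s k))
      <= kjac p * Num.min (h_k k) (radius s k) ;
  trial_radius : forall k,
    `|trial s k - iterate s k| <= krad p * radius s k ;
  sufficient_decrease : forall k,
    ((kfcd p * h_k k *
        Num.min (h_k k / (1 + opnorm (model_hess s k))) (radius s k))%:E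
      <= model k (iterate s k) - model k (trial s k))%E ;
  cred_accuracy : forall k,
    `|ared_k k - cred s k|
      <= kobj p * (eta p * Num.min (pred_k k) (obj_tol s k)) `^ zeta p ;
  (* Makes every quotient [ratio k] well defined. *)
  pred_neq0 : forall k, pred_k k != 0 ;
  step_rejected : forall k, ratio k < eta1 p ->
    iterate s k.+1 = iterate s k /\
    gamma1 p * radius s k <= radius s k.+1 <= gamma2 p * radius s k ;
  step_accepted : forall k, eta1 p <= ratio k ->
    iterate s k.+1 = trial s k ;
  radius_successful : forall k, eta1 p <= ratio k < eta2 p ->
    gamma2 p * radius s k <= radius s k.+1 <= radius s k ;
  radius_very_successful : forall k, eta2 p <= ratio k ->
    radius s k <= radius s k.+1 <= gamma3 p * radius s k
}.

End algorithm.

(* Main.v *)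
Require Import Defs.
From HB Require Import structures.
From mathcomp Require Import all_boot all_order all_algebra.
From mathcomp Require Import all_classical all_reals all_analysis.
From mathcomp Require Import ring lra.
Set Implicit Arguments.
Unset Strict Implicit.
Unset Printing Implicit Defensive.

Import Order.TTheory GRing.Theory Num.Theory.
Import numFieldNormedType.Exports.
Local Open Scope classical_set_scope.
Local Open Scope ring_scope.

(** Suppose that [h_k] stays above some [e > 0] from a certain index on, and
write [a_k = 1 + max_(j <= k) |B_j|].

The first-order expansions of [f0] and [f1] and the accuracy demanded of [g_k],
[b_k], [A_k] make the model agree with the objective up to
[C (1 + |B_k|) Delta_k ^ 2] ([ared_pred_close]), whereas the decrease of the
model is at least of order [e * min {e / (1 + |B_k|), Delta_k}]. The inexactness
of [cred_k] costs at most the fraction [eta] of that decrease in the long run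
([ared_cred_close]). So an iteration with [(1 + |B_k|) Delta_k] below a fixed
threshold is very successful and does not shrink the radius; hence
[Delta_k >= c / a_k] for some [c > 0]. An accepted step then decreases [J] by a
fixed multiple of [1 / a_k]; since [J] is bounded below, [1 / a_k] is summable
along accepted steps.

Rejected steps are controlled by a Lyapunov function
([summable_of_radius_dynamics]). With [u_k = 1 / a_k], the quantity
[u_k (1 + ln (Delta_k / (c u_k)))] is nonnegative, loses at least a fixed
multiple of [u_k] when a step is rejected, because the radius contracts by
[gamma2 < 1], and gains at most a multiple of [u_k] when a step is accepted, a
gain already known to be paid for by [J]. Hence the whole series of the [u_k]
converges, against the assumption ([curvature_series_converges]).

The second claim compares the proximal points for two step lengths [t] and
[t']: adding up their optimality conditions shows that either the displacement
[t H_k(t)] or the quotient [H_k(t)] is smaller at [t] than at [t'], so that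
[H_k(t) <= max 1 (t_k / t) * h_k] ([prox_step_le]). This uses that the proximal
points are true minimizers. In a Hilbert space a minimizing sequence of a
strongly convex function is a Cauchy sequence ([prox_ex]). The same existence
result yields the Riesz representation theorem ([riesz_representation]), which
makes [grad] represent the differential. *)

(** * Inner products and operator norms *)

Section inner_product.
Context {R : realType} {X : hilbertType R}.
Implicit Types (u v w : X) (a : R).

Lemma innerDr u v w : inner u (v + w) = inner u v + inner u w.
Proof. by rewrite innerC innerDl !(innerC u). Qed.

Lemma innerZr a u v : inner u (a *: v) = a * inner u v.
Proof. by rewrite innerC innerZl (innerC u). Qed.

Lemma innerNl u v : inner (- u) v = - inner u v.
Proof. by rewrite -scaleN1r innerZl mulN1r. Qed.

Lemma innerNr u v : inner u (- v) = - inner u v.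
Proof. by rewrite innerC innerNl innerC. Qed.

Lemma innerBl u v w : inner (u - v) w = inner u w - inner v w.
Proof. by rewrite innerDl innerNl. Qed.

Lemma innerBr u v w : inner u (v - w) = inner u v - inner u w.
Proof. by rewrite innerDr innerNr. Qed.

Lemma norm_sqrD u v : `|u + v| ^+ 2 = `|u| ^+ 2 + 2 * inner u v + `|v| ^+ 2.
Proof.
rewrite -!inner_norm innerDl !innerDr (innerC v u); ring.
Qed.

Lemma norm_sqrB u v : `|u - v| ^+ 2 = `|u| ^+ 2 - 2 * inner u v + `|v| ^+ 2.
Proof. by rewrite norm_sqrD normrN innerNr; ring. Qed.

(** The squared norm of [`|v| *: u - `|u| *: v] is nonnegative. *)
Lemma inner_le_norm u v : inner u v <= `|u| * `|v|.
Proof.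
have [/eqP|u0] := eqVneq `|u| 0.
  by rewrite normr_eq0 => /eqP ->; rewrite -(scale0r 0) innerZl mul0r mulr_ge0.
have [/eqP|v0] := eqVneq `|v| 0.
  by rewrite normr_eq0 => /eqP ->; rewrite -(scale0r 0) innerZr mul0r mulr_ge0.
have p0 : 0 < `|u| * `|v| by rewrite mulr_gt0 ?lt_def ?u0 ?v0 ?normr_ge0.
have := sqr_ge0 (`| `|v| *: u - `|u| *: v|).
rewrite norm_sqrB !normrZ !normr_id innerZl innerZr => h.
rewrite -(ler_pM2l p0); nra.
Qed.

Lemma norm_inner u v : `|inner u v| <= `|u| * `|v|.
Proof.
by rewrite ler_norml inner_le_norm andbT lerNl -innerNl -(normrN u) inner_le_norm.
Qed.

End inner_product.

Section operator_norm.
Context {R : realType} {V W : normedModType R}.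
Implicit Type f : V -> W.

Lemma opnorm_ge0 f : 0 <= opnorm f.
Proof.
have [h|h] := pselect (has_sup [set `|f v| | v in [set v : V | `|v| <= 1]]).
  apply: (@le_trans _ _ `|f 0|) => //; apply: (sup_upper_bound h).
  by exists 0 => //=; rewrite normr0.
by rewrite /opnorm sup_out.
Qed.

(** A bound at the scale of the unit ball, homogeneity doing the rest. *)
Lemma opnorm_le f (v : V) : bounded_fun_norm f ->
  (forall (a : R) x, f (a *: x) = a *: f x) -> `|f v| <= opnorm f * `|v|.
Proof.
move=> bf fZ; have [->|v0] := eqVneq v 0.
  by rewrite -(scale0r 0) fZ !scale0r !normr0 mulr0.
have nv0 : 0 < `|v| by rewrite normr_gt0.
rewrite -ler_pdivrMr// mulrC -(@gtr0_norm _ (`|v|^-1)) ?invr_gt0//.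
rewrite -normrZ -fZ; apply: ub_le_sup.
  by have [M fM] := bf 1; exists M => _ [w w1 <-]; exact: fM.
exists (`|v|^-1 *: v) => //=.
by rewrite normrZ gtr0_norm ?invr_gt0// mulVf ?gt_eqF.
Qed.

End operator_norm.

(** * Existence and optimality of proximal points *)

Section prox.
Context {R : realType} {X : hilbertType R}.
Implicit Types (psi : X -> \bar R) (x y z : X).

Lemma dom_fineK psi x : Defs.proper psi -> Defs.dom psi x -> psi x = (fine (psi x))%:E.
Proof.
by move=> [nN _] /= dx; rewrite fineK// fin_numE nN/= lt_eqF.
Qed.

Lemma fine_convex psi x y (t : R) : Defs.proper psi -> convex_efunction psi ->
  Defs.dom psi x -> Defs.dom psi y -> 0 <= t <= 1 ->
  Defs.dom psi (t *: x + (1 - t) *: y) /\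
  fine (psi (t *: x + (1 - t) *: y)) <= t * fine (psi x) + (1 - t) * fine (psi y).
Proof.
move=> pp cp dx dy t01; have := cp x y t t01.
rewrite (dom_fineK pp dx) (dom_fineK pp dy) -!EFinM -EFinD => h.
have dz : Defs.dom psi (t *: x + (1 - t) *: y) by apply: le_lt_trans h _; rewrite ltry.
by split=> //; move: h; rewrite (dom_fineK pp dz) lee_fin.
Qed.

(** Closedness bounds the function below near a point of its domain, and
convexity propagates that bound along rays, where it degrades linearly. *)
Lemma proper_closed_convex_minorant psi x : Defs.proper psi -> closed_function psi ->
  convex_efunction psi ->
  exists a c : R, 0 <= c /\
    forall y, Defs.dom psi y -> a - c * `|y - x| <= fine (psi y).
Proof.
move=> pp clp cp; have [_ [x0 dx0]] := pp.
set r0 := fine (psi x0).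
have epi0 : ~ [set q : X * R | (psi q.1 <= q.2%:E)%E] (x0, r0 - 1).
  by rewrite /= (dom_fineK pp dx0) lee_fin -/r0; apply/negP; rewrite -ltNge; lra.
have := @closed_openC _ _ clp; rewrite openE => /(_ _ epi0).
move=> /nbhs_ballP[d /= d0 bd].
have near0 y : `|y - x0| < d -> r0 - 1 <= fine (psi y) \/ ~ Defs.dom psi y.
  move=> yd; have [dy|] := pselect (Defs.dom psi y); [left|by right].
  have /= := bd (y, r0 - 1); have /[swap]/[apply] : ball (x0, r0 - 1) d (y, r0 - 1).
    by split => /=; [rewrite -ball_normE /= distrC|exact: ballxx].
  rewrite (dom_fineK pp dy) lee_fin => /negP; rewrite -ltNge; exact: ltW.
have d2 : 0 < 2 / d by rewrite divr_gt0.
exists (r0 - 1 - 2 / d * `|x - x0|), (2 / d); split; first exact: ltW.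
move=> y dy; have tri : `|y - x0| <= `|y - x| + `|x - x0|.
  by rewrite -[y - x0](subrKA x) ler_normD.
suff key : r0 - 1 - 2 / d * `|y - x0| <= fine (psi y).
  by apply: le_trans key; have := ler_wpM2l (ltW d2) tri; lra.
have [yd|dy0] := ltP `|y - x0| d.
  have [h|//] := near0 _ yd; apply: le_trans h.
  by rewrite gerBl mulr_ge0// ltW.
set r := `|y - x0|; have r_gt0 : 0 < r by exact: lt_le_trans dy0.
(* The weight putting the point between x0 and y at distance d / 2 from x0. *)
pose t := d / (2 * r).
have t0 : 0 < t by rewrite divr_gt0// mulr_gt0.
have t1 : t <= 1 by rewrite ler_pdivrMr ?mulr_gt0//; rewrite -/r in dy0; lra.
have t01 : 0 <= t <= 1 by rewrite (ltW t0).
have [dw cw] := fine_convex pp cp dy dx0 t01.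
have wd : `|t *: y + (1 - t) *: x0 - x0| < d.
  have -> : t *: y + (1 - t) *: x0 - x0 = t *: (y - x0).
    rewrite scalerBl scale1r scalerBr -!addrA; congr (_ + _).
    by rewrite addrCA subrr addr0.
  rewrite normrZ gtr0_norm// -/r /t invfM mulrA divfK ?gt_eqF//; lra.
have [h|//] := near0 _ wd.
have tE : t * (2 / d * r) = 1 by rewrite /t; field; rewrite !gt_eqF.
rewrite -(ler_pM2l t0); rewrite -/r0 in cw; lra.
Qed.

(** The parallelogram law, as the strong convexity of the squared norm. *)
Lemma norm_sqr_midpoint (x y z : X) :
  `|2^-1 *: y + (1 - 2^-1) *: z - x| ^+ 2 =
  2^-1 * `|y - x| ^+ 2 + 2^-1 * `|z - x| ^+ 2 - 4^-1 * `|y - z| ^+ 2.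
Proof.
have -> : 2^-1 *: y + (1 - 2^-1) *: z - x = 2^-1 *: ((y - x) + (z - x)).
  have xE : x = 2^-1 *: x + 2^-1 *: x.
    by rewrite -scalerDl (_ : _ + _ = 1) ?scale1r//; lra.
  rewrite (_ : 1 - 2^-1 = 2^-1 :> R); last by lra.
  by rewrite [in LHS]xE scalerDr !scalerBr opprD addrACA.
have -> : y - z = (y - x) - (z - x) by rewrite opprB addrA subrK.
rewrite normrZ exprMn gtr0_norm ?invr_gt0//.
by rewrite (norm_sqrD (y - x) (z - x)) (norm_sqrB (y - x) (z - x)); lra.
Qed.

(** By strong convexity two points whose values are close to the infimum are
close to each other, so a minimizing sequence converges. Closedness of the
epigraph bounds the value at its limit. *)
Lemma prox_ex psi x : Defs.proper psi -> closed_function psi ->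
  convex_efunction psi ->
  exists z, forall y, ((2^-1 * `|z - x| ^+ 2)%:E + psi z
                         <= (2^-1 * `|y - x| ^+ 2)%:E + psi y)%E.
Proof.
move=> pp clp cp; have [_ [x0 dx0]] := pp.
have [a [c [c0 ac]]] := proper_closed_convex_minorant x pp clp cp.
pose F y : R := 2^-1 * `|y - x| ^+ 2 + fine (psi y).
pose S := [set F y | y in Defs.dom psi].
have infS : has_inf S.
  split; first by exists (F x0), x0.
  exists (a - 2^-1 * c ^+ 2) => _ [y dy <-]; rewrite /F.
  have := ac _ dy; have := sqr_ge0 (`|y - x| - c); nra.
have mF y : Defs.dom psi y -> inf S <= F y.
  by move=> dy; apply: ge_inf; [exact: infS.2|exists y].
have /choice[y_ y_P] n : exists y, Defs.dom psi y /\ F y < inf S + n.+1%:R^-1.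
  have n0 : 0 < n.+1%:R^-1 :> R by rewrite invr_gt0.
  by have [_ [y dy <-] h] := inf_adherent n0 infS; exists y.
have cy n k : `|y_ n - y_ k| ^+ 2 <= 4 * (n.+1%:R^-1 + k.+1%:R^-1).
  have [dn Fn] := y_P n; have [dk Fk] := y_P k.
  have h01 : 0 <= (2^-1 : R) <= 1 by lra.
  have [dw] := fine_convex pp cp dn dk h01.
  have := mF _ dw; rewrite /F norm_sqr_midpoint.
  by move: Fn Fk; rewrite /F; move: n.+1%:R^-1 k.+1%:R^-1 => a1 a2; lra.
have /cauchy_cvgP yz : cauchy (y_ @ \oo).
  apply: cauchy_exP => e e0.
  have e8 : 0 < e ^+ 2 / 8 by rewrite divr_gt0// exprn_gt0.
  have [N _ Ne] := near_infty_natSinv_lt (PosNum e8).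
  exists (y_ N); exists N => // n /= Nn; rewrite -ball_normE /=.
  rewrite -(ltr_pXn2r (n:=2))// ?nnegrE//; last exact: ltW.
  apply: le_lt_trans (cy _ _) _.
  have := Ne N (leqnn N); have := Ne n Nn => /=.
  by move: n.+1%:R^-1 N.+1%:R^-1 => a1 a2; lra.
set z := lim (y_ @ \oo) in yz.
(* r n bounds psi (y_ n), so (y_ n, r n) lies in the epigraph, which is closed. *)
pose r n := inf S + n.+1%:R^-1 - 2^-1 * `|y_ n - x| ^+ 2.
have rz : r @ \oo --> inf S - 2^-1 * `|z - x| ^+ 2.
  have nz : `|y_ n - x| @[n --> \oo] --> `|z - x|.
    by apply: cvg_norm; apply: cvgB => //; exact: cvg_cst.
  apply: cvgB; last exact: (cvgM (cvg_cst _) (cvgM nz nz)).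
  rewrite -[X in _ --> X]addr0; apply: cvgD; [exact: cvg_cst|exact: cvg_harmonic].
have : [set q : X * R | (psi q.1 <= q.2%:E)%E] (z, inf S - 2^-1 * `|z - x| ^+ 2).
  apply: (closed_cvg (F:=\oo) (u_ := fun n => (y_ n, r n))) => //.
  - apply: nearW => n /=; have [dn Fn] := y_P n.
    rewrite (dom_fineK pp dn) lee_fin /r; move: Fn; rewrite /F.
    by move: n.+1%:R^-1 => a1; lra.
  - exact: (cvg_pair yz rz).
move=> /= psiz; exists z => y.
have dz : Defs.dom psi z by apply: le_lt_trans psiz _; rewrite ltry.
have [dy|] := pselect (Defs.dom psi y); last first.
  rewrite /Defs.dom /= => /negP; rewrite -leNgt leye_eq => /eqP ->.
  by rewrite addey// leey.
move: psiz; rewrite (dom_fineK pp dz) (dom_fineK pp dy) -!EFinD !lee_fin.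
by have := mF _ dy; rewrite /F; lra.
Qed.

Lemma prox_min psi x y : Defs.proper psi -> closed_function psi ->
  convex_efunction psi ->
  ((2^-1 * `|prox psi x - x| ^+ 2)%:E + psi (prox psi x)
     <= (2^-1 * `|y - x| ^+ 2)%:E + psi y)%E.
Proof.
by move=> pp clp cp; have := xgetPex 0 (prox_ex x pp clp cp); apply.
Qed.

Lemma prox_dom psi x : Defs.proper psi -> closed_function psi ->
  convex_efunction psi -> Defs.dom psi (prox psi x).
Proof.
move=> pp clp cp; have [pN [y dy]] := pp.
have := prox_min x y pp clp cp; rewrite (dom_fineK pp dy) -EFinD.
rewrite /Defs.dom /=; have := pN (prox psi x).
by case: (psi (prox psi x)) => //= r _ _; rewrite ltry.
Qed.

(** The first-order optimality condition of the proximal problem, obtained by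
letting the competitor slide towards the minimizer along a segment. *)
Lemma prox_variational psi x y : Defs.proper psi -> closed_function psi ->
  convex_efunction psi -> Defs.dom psi y ->
  inner (x - prox psi x) (y - prox psi x) <= fine (psi y) - fine (psi (prox psi x)).
Proof.
move=> pp clp cp dy; have dz := prox_dom x pp clp cp.
set z := prox psi x in dz *.
set I := inner _ _; set D := `|y - z| ^+ 2.
have D0 : 0 <= D by exact: sqr_ge0.
have key t : 0 < t -> t <= 1 -> I <= fine (psi y) - fine (psi z) + t * (2^-1 * D).
  move=> t0 t1; have t01 : 0 <= t <= 1 by rewrite (ltW t0).
  have [dw cw] := fine_convex pp cp dy dz t01.
  have := prox_min x (t *: y + (1 - t) *: z) pp clp cp; rewrite -/z.
  rewrite (dom_fineK pp dz) (dom_fineK pp dw) -!EFinD lee_fin.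
  have -> : t *: y + (1 - t) *: z - x = t *: (y - z) - (x - z).
    rewrite scalerBl scale1r scalerBr opprB addrA.
    rewrite -!addrA; congr (_ + _); rewrite addrC -!addrA; congr (_ + _).
    by rewrite addrC.
  rewrite (norm_sqrB (t *: _)) normrZ gtr0_norm// exprMn innerZl (innerC (y - z)) -/I -/D.
  rewrite (distrC z x) => h; rewrite -(ler_pM2l t0); lra.
rewrite leNgt; apply/negP => h.
pose d := I - (fine (psi y) - fine (psi z)).
have d0 : 0 < d by rewrite subr_gt0.
(* At t = d / (d + D) the quadratic term t * D / 2 is at most d / 2, less than
   the excess d. *)
have t0 : 0 < d / (d + D) by rewrite divr_gt0// ltr_pwDl.
have dD : 0 < d + D by rewrite ltr_pwDl.
have t1 : d / (d + D) <= 1 by rewrite ler_pdivrMr// mul1r lerDl.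
have := key _ t0 t1.
have : d / (d + D) * (2^-1 * D) <= 2^-1 * d.
  by rewrite mulrAC ler_pdivrMr//; nra.
by rewrite /d in d0 *; lra.
Qed.

End prox.

(** * Stability of proper closed convex functions *)

Section admissible_functions.
Context {R : realType} {X : hilbertType R}.
Implicit Types (psi : X -> \bar R) (u : X -> R) (t : R).

Lemma proper_addl u psi : Defs.proper psi ->
  Defs.proper (fun x => (u x)%:E + psi x)%E.
Proof.
move=> [pN [y dy]]; split=> [x|].
  by have := pN x; case: (psi x).
exists y; move: dy; rewrite /Defs.dom /= => dy.
by rewrite lte_add_pinfty// ltry.
Qed.

(** The epigraph of the sum is the preimage of that of [psi] under the
continuous map [(x, r) |-> (x, r - u x)]. *)
Lemma closed_function_addl u psi : continuous (u : X -> R^o) ->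
  closed_function psi -> closed_function (fun x => (u x)%:E + psi x)%E.
Proof.
move=> cu clp; rewrite /closed_function.
have -> : [set q : X * R | ((u q.1)%:E + psi q.1 <= q.2%:E)%E] =
    (fun q : X * R => (q.1, q.2 - u q.1)) @^-1`
      [set q : X * R | (psi q.1 <= q.2%:E)%E].
  by apply/seteqP; split => -[x r] /=; rewrite EFinB leeBrDl.
apply: closed_comp => // q0 _.
have c1 : q.1 @[q --> q0] --> q0.1 by exact: cvg_fst.
have c2 : q.2 @[q --> q0] --> q0.2 by exact: cvg_snd.
have c3 : u q.1 @[q --> q0] --> u q0.1.
  by apply: (@cvg_comp _ _ _ fst u _ _ _ c1); exact: cu.
have c4 : (q.2 - u q.1) @[q --> q0] --> q0.2 - u q0.1 by exact: (cvgB c2 c3).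
exact: (cvg_pair c1 c4).
Qed.

Lemma convex_addl u psi :
  (forall x y t, 0 <= t <= 1 ->
    u (t *: x + (1 - t) *: y) <= t * u x + (1 - t) * u y) ->
  (forall x, psi x != -oo%E) ->
  convex_efunction psi -> convex_efunction (fun x => (u x)%:E + psi x)%E.
Proof.
move=> cu pN cp x y t t01; have := cp x y t t01; have := cu x y t t01.
have /andP[t0 t1] := t01; have t1' : 0 <= 1 - t by rewrite subr_ge0.
rewrite !muleDr ?fin_num_adde_defr// -!EFinM => ucvx psicvx.
rewrite addeACA -EFinD; apply: leeD => //.
Qed.

Lemma proper_scale t psi : 0 < t -> Defs.proper psi ->
  Defs.proper (fun x => t%:E * psi x)%E.
Proof.
move=> t0 [pN [y dy]]; split=> [x|].
  by have := pN x; case: (psi x) => // _; rewrite gt0_muley// lte_fin.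
exists y; move: (pN y) dy; rewrite /Defs.dom /=.
by case: (psi y) => //= r _ _; rewrite -EFinM ltry.
Qed.

Lemma closed_function_scale t psi : 0 < t -> closed_function psi ->
  closed_function (fun x => t%:E * psi x)%E.
Proof.
move=> t0 clp; rewrite /closed_function.
have -> : [set q : X * R | (t%:E * psi q.1 <= q.2%:E)%E] =
    (fun q : X * R => (q.1, t^-1 * q.2)) @^-1`
      [set q : X * R | (psi q.1 <= q.2%:E)%E].
  by apply/seteqP; split => -[x r] /=; rewrite EFinM lee_pdivlMl.
apply: closed_comp => // q0 _.
have c1 : q.1 @[q --> q0] --> q0.1 by exact: cvg_fst.
have c2 : q.2 @[q --> q0] --> q0.2 by exact: cvg_snd.
exact: (cvg_pair c1 (cvgM (cvg_cst _) c2)).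
Qed.

Lemma convex_scale t psi : 0 < t -> (forall x, psi x != -oo%E) ->
  convex_efunction psi -> convex_efunction (fun x => t%:E * psi x)%E.
Proof.
move=> t0 pN cp x y a a01; have := cp x y a a01.
have /andP[a0 a1] := a01; have a1' : 0 <= 1 - a by rewrite subr_ge0.
have N b z : 0 <= b -> (-oo < b%:E * psi z)%E.
  rewrite le_eqVlt => /predU1P[<-|b0]; first by rewrite mul0e ltNyr.
  have := pN z; case: (psi z) => //= [r|] _; first by rewrite -EFinM ltNyr.
  by rewrite gt0_muley// lte_fin.
move=> /(lee_wpmul2l (_ : 0%:E <= t%:E)%E) h.
apply: le_trans (h _) _; first by rewrite lee_fin ltW.
by rewrite muleDr ?ltninfty_adde_def ?inE ?N//= muleCA (muleCA t%:E).
Qed.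

End admissible_functions.

(** * Riesz representation *)

Section riesz.
Context {R : realType} {X : hilbertType R}.

(** The energy [|y| ^ 2 / 2 - L y] is minimized by the proximal point of [- L] at
the origin; its optimality condition, tested in the directions [v] and [- v], is
the representation of [L]. *)
Lemma riesz_representation (L : X -> R) :
  (forall a u v, L (a *: u + v) = a * L u + L v) ->
  continuous (L : X -> R^o) -> exists g, forall v, L v = inner g v.
Proof.
move=> linL cL; pose psi x := ((- L x)%:E + (cst 0%E : X -> \bar R) x)%E.
have L0 : L 0 = 0.
  by have := linL 1 0 0; rewrite scale1r addr0 mul1r => h; lra.
have pp : Defs.proper psi.
  by apply: proper_addl; split=> //; exists 0; rewrite /Defs.dom /= ltry.
have clp : closed_function psi.
  apply: closed_function_addl; first by move=> x; apply: cvgN; exact: cL.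
  rewrite /closed_function /=.
  have -> : [set q : X * R | (0 <= q.2%:E)%E] = snd @^-1` [set r : R | 0 <= r].
    by apply/seteqP; split => q /=; rewrite lee_fin.
  by apply: closed_comp; [move=> q _; exact: cvg_snd|exact: closed_ge].
have cp : convex_efunction psi.
  apply: convex_addl => // [x y t _|x y t _]; last by rewrite !mule0 adde0.
  have := linL t x ((1 - t) *: y); have := linL (1 - t) y 0.
  by rewrite addr0 L0 => -> ->; lra.
exists (prox psi 0) => v; set z := prox psi 0.
have fpsi x : fine (psi x) = - L x by rewrite /psi /= addr0.
have L1 w : L (z + w) = L z + L w.
  by have := linL 1 z w; rewrite scale1r mul1r.
have key w : - inner z w <= - L w.
  have := @prox_variational _ _ psi 0 (z + w) pp clp cp.
  rewrite -/z !fpsi L1 sub0r addrAC subrr add0r innerNl => h.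
  by have := h (ltry _); lra.
have := key v; have := key (- v).
have -> : L (- v) = - L v.
  by have := linL (-1) v 0; rewrite scaleN1r !addr0 L0 addr0 mulN1r.
by rewrite innerNr => h1 h2; apply/eqP; rewrite eq_le; apply/andP; split; lra.
Qed.

Lemma grad_spec (f : X -> R) x v : differentiable (f : X -> R^o) x ->
  'd (f : X -> R^o) x v = inner (grad f x) v.
Proof.
move=> df; rewrite /grad.
have [g gP] : exists g : X, forall v, 'd (f : X -> R^o) x v = inner g v.
  apply: riesz_representation; last exact: diff_continuous.
  by move=> a u w; rewrite linearP.
by have /(_ v) := xgetPex 0 (ex_intro (fun g => forall v, _ = inner g v) g gP).
Qed.

End riesz.

(** * Dependence of proximal points on the step length *)

Section prox_step_length.
Context {R : realType} {X : hilbertType R}.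

(** Test the optimality condition at each of the two points against the other
one, and add the results with weights [t'] and [t]: the values of [psi] and the
terms in [g] cancel, and Cauchy-Schwarz leaves a factored quadratic form in the
displacements. *)
Lemma prox_displacement_cmp (psi : X -> \bar R) (x g : X) (t t' : R) :
  Defs.proper psi -> closed_function psi -> convex_efunction psi ->
  0 < t -> 0 < t' ->
  let a := `|prox (fun y => t%:E * psi y)%E (x - t *: g) - x| in
  let b := `|prox (fun y => t'%:E * psi y)%E (x - t' *: g) - x| in
  (a - b) * (t' * a - t * b) <= 0.
Proof.
move=> pp clp cp t0 t'0.
have vi s y : 0 < s -> Defs.dom psi y ->
    let z := prox (fun y => s%:E * psi y)%E (x - s *: g) in
    Defs.dom psi z /\
    inner (x - s *: g - z) (y - z) <= s * fine (psi y) - s * fine (psi z).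
  move=> s0 dy z; have [ps cls cs] : [/\ Defs.proper (fun y => s%:E * psi y)%E,
      closed_function (fun y => s%:E * psi y)%E &
      convex_efunction (fun y => s%:E * psi y)%E].
    split; [exact: proper_scale|exact: closed_function_scale|].
    by apply: convex_scale => //; exact: pp.1.
  have dz : Defs.dom psi z.
    have := prox_dom (x - s *: g) ps cls cs; rewrite -/z /Defs.dom /=.
    by case: (psi z) => [r||]; rewrite ?ltry ?ltNyr// gt0_muley ?lte_fin.
  split=> //; have := @prox_variational _ _ _ (x - s *: g) y ps cls cs.
  rewrite -/z (dom_fineK pp dy) (dom_fineK pp dz) -!EFinM /=; apply.
  by rewrite /Defs.dom /= (dom_fineK pp dy) -EFinM ltry.
have [_ [x0 dx0]] := pp.
set P := prox _ (x - t *: g); set Q := prox _ (x - t' *: g) => /=.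
have [dP _] := vi _ _ t0 dx0; have [dQ _] := vi _ _ t'0 dx0.
have [_ hP] := vi _ _ t0 dQ; have [_ hQ] := vi _ _ t'0 dP.
rewrite -/P -/Q in dP dQ hP hQ.
pose d := P - x; pose e := Q - x.
have e1 : Q - P = e - d by rewrite /d /e opprB addrA subrK.
have e2 : P - Q = d - e by rewrite /d /e opprB addrA subrK.
have e3 : x - t *: g - P = - (d + t *: g) by rewrite /d opprD opprB addrAC.
have e4 : x - t' *: g - Q = - (e + t' *: g) by rewrite /e opprD opprB addrAC.
move: hP hQ; rewrite e1 e2 e3 e4 -/d -/e; clearbody d e => {e1 e2 e3 e4}.
rewrite !innerNl !innerDl !innerBr !innerZl !inner_norm (innerC e d) => hP hQ.
have cs := inner_le_norm d e; set I := inner d e in hP hQ cs.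
set G := inner g e in hP hQ; set G' := inner g d in hP hQ.
have hP' := ler_wpM2l (ltW t'0) hP; have hQ' := ler_wpM2l (ltW t0) hQ.
have cs' := ler_wpM2l (ltW (addr_gt0 t0 t'0)) cs.
move: hP' hQ' cs'; set A := `|d|; set B := `|e|.
set u := fine (psi P); set v := fine (psi Q) => hP' hQ' cs'; nra.
Qed.

(** By the sign of the product in [prox_displacement_cmp], either the
displacement or its quotient by the step length is smaller at [t] than at
[t']; each case gives one of the two arguments of the maximum. *)
Lemma prox_step_le (psi : X -> \bar R) (x g : X) (t t' : R) :
  Defs.proper psi -> closed_function psi -> convex_efunction psi ->
  0 < t -> 0 < t' ->
  t^-1 * `|prox (fun y => t%:E * psi y)%E (x - t *: g) - x| <=
  Num.max 1 (t' / t) *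
    (t'^-1 * `|prox (fun y => t'%:E * psi y)%E (x - t' *: g) - x|).
Proof.
move=> pp clp cp t0 t'0; have := prox_displacement_cmp x g pp clp cp t0 t'0.
set a := `|prox _ (x - t *: g) - x|; set b := `|prox _ (x - t' *: g) - x| => /= h.
have b0 : 0 <= b by exact: normr_ge0.
have m1 : 1 <= Num.max 1 (t' / t) by rewrite le_max lexx.
have m2 : t' / t <= Num.max 1 (t' / t) by rewrite le_max lexx orbT.
have c0 : 0 <= t'^-1 * b by rewrite mulr_ge0// invr_ge0 ltW.
have [ab|ba] := leP a b.
  apply: le_trans (ler_wpM2r c0 m2).
  by rewrite mulrACA mulfV ?gt_eqF// mul1r ler_pM2l// invr_gt0.
apply: le_trans (ler_wpM2r c0 m1); rewrite mul1r.
rewrite ler_pdivrMl// mulrCA ler_pdivlMl// -subr_le0.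
by rewrite -(pmulr_rle0 _ (_ : 0 < a - b))// subr_gt0.
Qed.

End prox_step_length.

(** * Remainders of first-order expansions *)

Section first_order_remainder.
Context {R : realType} {X Y : hilbertType R}.

Lemma derive_along_segment (F : X -> R) (x s : X) (t : R) :
  differentiable (F : X -> R^o) (x + t *: s) ->
  is_derive t (1 : R) (fun r : R => F (x + r *: s) : R)
    ('d (F : X -> R^o) (x + t *: s) s).
Proof.
move=> dF; have dv := diff_derivable dF (v := s).
(* The difference quotients of the restriction are those of F along s. *)
have E :
    (fun h : R => h^-1 *:
       (((fun r : R => F (x + r *: s)) \o shift t) (h *: (1 : R))
        - F (x + t *: s))) =
    (fun h : R => h^-1 *:
       (((F : X -> R^o) \o shift (x + t *: s)) (h *: s) - F (x + t *: s))).
  apply/funext => h /=; congr (_ *: (F _ - _)).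
  by rewrite -[h *: 1]/(h * 1) mulr1 scalerDl addrCA.
split; first by rewrite /derivable E.
by rewrite -(deriveE s dF) /derive E.
Qed.

(** The mean value theorem along the segment writes the increment of [F] as
one value of the differential. *)
Lemma remainder_le (F : X -> R) (x s : X) (K : R) :
  (forall t, 0 <= t <= 1 -> differentiable (F : X -> R^o) (x + t *: s)) ->
  (forall t, 0 <= t <= 1 ->
    `|'d (F : X -> R^o) (x + t *: s) s - 'd (F : X -> R^o) x s| <= K) ->
  `|F (x + s) - F x - 'd (F : X -> R^o) x s| <= K.
Proof.
move=> dF dK.
have [||c c01] := @MVT R (fun r => F (x + r *: s))
    (fun r => 'd (F : X -> R^o) (x + r *: s) s) 0 1 ltr01.
- move=> t; rewrite in_itv /= => /andP[t0 t1]; apply: derive_along_segment.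
  by apply: dF; rewrite !ltW.
- apply: derivable_within_continuous => t; rewrite in_itv /= => t01.
  by have [] := derive_along_segment (dF _ t01).
rewrite scale1r scale0r addr0 subr0 mulr1 => ->; apply: dK.
by move: c01; rewrite in_itv /= => /andP[? ?]; rewrite !ltW.
Qed.

Lemma diff_bounded (V W : normedModType R) (f : V -> W) x :
  differentiable f x -> bounded_fun_norm ('d f x).
Proof.
move=> df; apply/bounded_funP; apply: continuous_linear_bounded.
exact: diff_continuous.
Qed.

Lemma bounded_fun_normB (V W : normedModType R) (f g : V -> W) :
  bounded_fun_norm f -> bounded_fun_norm g -> bounded_fun_norm (f \- g).
Proof.
move=> bf bg r; have [M fM] := bf r; have [N gN] := bg r.
exists (M + N) => x xr; apply: le_trans (ler_normB _ _) _.
by apply: lerD; [exact: fM|exact: gN].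
Qed.

(** The codomain [R^o], rather than [R], makes this a linear map between normed
modules, as the calculus of differentials requires. *)
Definition inner_right (w u : Y) : R^o := inner u w.

Lemma inner_right_linear w : linear (inner_right w).
Proof. by move=> a u v; rewrite /inner_right innerDl innerZl. Qed.

HB.instance Definition _ (w : Y) :=
  GRing.isLinear.Build R Y R^o _ (inner_right w) (inner_right_linear w).

Lemma inner_right_continuous w : continuous (inner_right w).
Proof.
apply: bounded_linear_continuous; apply/bounded_funP => r; exists (`|r| * `|w|).
move=> u ur; apply: le_trans (norm_inner _ _) _.
by rewrite ler_wpM2r// (le_trans ur)// ler_norm.
Qed.

Lemma diff_inner_right (f : X -> Y) w x s : differentiable f x ->
  differentiable ((fun y => inner (f y) w) : X -> R^o) x /\
  'd ((fun y => inner (f y) w) : X -> R^o) x s = inner ('d f x s) w.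
Proof.
move=> df; have dw y := linear_differentiable y (@inner_right_continuous w).
split; first exact: (differentiable_comp df (dw _)).
have := diff_comp df (dw (f x)).
rewrite (diff_lin _ (@inner_right_continuous w)) => E.
by rewrite -[LHS]/('d (inner_right w \o f) x s) E.
Qed.

(** There is no mean value equality for vector-valued functions. Pairing [f]
with its own remainder [w] reduces the claim to the scalar case, which bounds
[`|w| ^+ 2] by [K * `|w|]. *)
Lemma vector_remainder_le (f : X -> Y) (x s : X) (K : R) :
  (forall t, 0 <= t <= 1 -> differentiable f (x + t *: s)) ->
  (forall t, 0 <= t <= 1 -> `|'d f (x + t *: s) s - 'd f x s| <= K) ->
  `|f (x + s) - f x - 'd f x s| <= K.
Proof.
move=> df dK; set w := _ - _.
have dfx : differentiable f x.
  by have := df 0; rewrite scale0r addr0; apply; rewrite lexx ler01.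
have K0 : 0 <= K by apply: le_trans (dK 0 _); rewrite ?lexx ?ler01.
have [-> |w0] := eqVneq w 0; first by rewrite normr0.
have := @remainder_le (fun y => inner (f y) w) x s (K * `|w|).
have [_ ->] := diff_inner_right w s dfx.
rewrite -!innerBl -/w inner_norm ger0_norm ?sqr_ge0// expr2 => h.
rewrite -(@ler_pM2r _ `|w|) ?normr_gt0//; apply: h => t t01.
  by have [] := diff_inner_right w s (df _ t01).
have [_ ->] := diff_inner_right w s (df _ t01).
by rewrite -innerBl (le_trans (norm_inner _ _))// ler_wpM2r// dK.
Qed.

End first_order_remainder.

(** * Numerical sequences *)

Section sequences.
Context {R : realType}.

Lemma limn_einf_eq0 (u : nat -> R) : (forall n, 0 <= u n) ->
  (forall e, 0 < e -> forall N, exists2 n, (N <= n)%N & u n < e) ->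
  limn_einf (fun n => (u n)%:E) = 0%E.
Proof.
move=> u0 ue; rewrite limn_einf_lim.
suff -> : einfs (fun n => (u n)%:E) = cst 0%E by exact: lim_cst.
apply/funext => N; rewrite /einfs /=; apply/eqP; rewrite eq_le; apply/andP; split.
  apply/lee_addgt0Pr => e e0; rewrite add0e.
  have [n Nn un] := ue _ e0 N.
  by apply: ge_ereal_inf; exists (u n)%:E; [exists n|rewrite lee_fin ltW].
by apply: le_ereal_inf_tmp => _ [n _ <-]; rewrite lee_fin.
Qed.

Lemma nneseries_lt_pinfty (u : nat -> R) (K : nat) (B : R) :
  (forall k, 0 <= u k) -> (forall n, \sum_(k < n) u (K + k)%N <= B) ->
  (\sum_(0 <= k <oo) (u k)%:E < +oo)%E.
Proof.
move=> u0 uB; pose A := \sum_(0 <= k < K) u k + B.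
apply: (@le_lt_trans _ _ A%:E); last exact: ltry.
apply: lime_le; first by apply: is_cvg_nneseries => k _ _; rewrite lee_fin.
apply: nearW => n; rewrite sumEFin lee_fin /A.
apply: (@le_trans _ _ (\sum_(0 <= k < K + n) u k)).
  rewrite (@big_cat_nat _ _ _ n 0 (K + n)) ?leq_addl//= lerDl.
  by apply: sumr_ge0.
rewrite (@big_cat_nat _ _ _ K) ?leq_addr//= lerD2l.
rewrite -{1}[K]add0n big_addn addKn big_mkord.
apply: le_trans (uB n); rewrite le_eqVlt; apply/orP; left; apply/eqP.
by apply: eq_bigr => i _; rewrite addnC.
Qed.

(** [D] plays the role of the radius, [J] that of the gap to the lower bound of
the objective. The function [f] below is [u * (1 + ln (D / (c * u)))]; for
[c * u <= D] it is nondecreasing in [u], so replacing [u k] by [u k.+1] does not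
increase it, and [f] changes by at most [u k * ln (D k.+1 / D k)]. This is
negative, proportionally to [u k], when [D] contracts; otherwise the gain is at
most [u k * ln g3], which the decrease of [J] compensates. *)
Lemma summable_of_radius_dynamics (u D J : nat -> R) (c g2 g3 C : R) :
  0 < c -> 0 < g2 < 1 -> 1 <= g3 -> 0 <= C ->
  (forall k, 0 < u k) -> (forall k, u k.+1 <= u k) ->
  (forall k, c * u k <= D k) -> (forall k, c * u k <= D k.+1) ->
  (forall k, 0 <= J k) ->
  (forall k, D k.+1 <= g2 * D k /\ J k.+1 <= J k \/
             D k.+1 <= g3 * D k /\ u k <= C * (J k - J k.+1)) ->
  exists B, forall n, \sum_(k < n) u k <= B.
Proof.
move=> c0 /andP[g20 g21] g31 C0 u0 umono uD uD' J0 dyn.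
have D0 k : 0 < D k by apply: lt_le_trans (uD k); rewrite mulr_gt0.
pose L k := ln (D k); pose U k := ln (u k).
pose f k := u k * (1 + L k - ln c - U k).
have lncu k : ln (c * u k) = ln c + U k by rewrite lnM ?posrE.
have lnD k : ln c + U k <= L k by rewrite -lncu ler_ln ?posrE// mulr_gt0.
have lnD' k : ln c + U k <= L k.+1 by rewrite -lncu ler_ln ?posrE// mulr_gt0.
have f0 k : 0 <= f k by have := lnD k; have := u0 k; rewrite /f => *; nra.
have fS k : f k.+1 <= f k + u k * (L k.+1 - L k).
  have uU : u k.+1 * (U k - U k.+1) <= u k - u k.+1.
    have r0 : 0 < u k / u k.+1 by rewrite divr_gt0.
    have : ln (u k / u k.+1) <= u k / u k.+1 - 1.
      by have := @le_ln1Dx R (u k / u k.+1 - 1); rewrite (addrC 1) subrK; apply; lra.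
    rewrite ln_div ?posrE// -/(U k) -/(U k.+1) => h.
    have := ler_wpM2l (ltW (u0 k.+1)) h.
    by rewrite (mulrBr _ (u k / _)) mulr1 mulrCA mulfV ?gt_eqF// mulr1.
  have := lnD' k; have := umono k; rewrite /f => h1 h2.
  have : 0 <= (u k - u k.+1) * (L k.+1 - (ln c + U k)) by rewrite mulr_ge0 ?subr_ge0.
  move: uU; nra.
pose l2 := - ln g2; pose l3 := ln g3.
have l20 : 0 < l2 by rewrite oppr_gt0 ln_lt0// g20.
have l30 : 0 <= l3 by rewrite ln_ge0.
pose V k := f k + (l2 + l3) * C * J k.
have V0 k : 0 <= V k by rewrite addr_ge0// !mulr_ge0// addr_ge0// ltW.
have VS k : V k.+1 + l2 * u k <= V k.
  have mulD a : 0 < a -> D k.+1 <= a * D k -> u k * (L k.+1 - L k) <= u k * ln a.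
    move=> a0 h; rewrite ler_pM2l// lerBlDr -lnM ?posrE//.
    by rewrite ler_ln ?posrE// mulr_gt0.
  have := fS k; rewrite /V; case: (dyn k) => -[hD hJ].
    have := mulD _ g20 hD.
    have : (l2 + l3) * C * J k.+1 <= (l2 + l3) * C * J k.
      by rewrite ler_wpM2l// mulr_ge0// addr_ge0// ltW.
    by rewrite /l2; lra.
  have := mulD _ (lt_le_trans ltr01 g31) hD; rewrite -/l3.
  have : (l2 + l3) * u k <= (l2 + l3) * (C * (J k - J k.+1)).
    by rewrite ler_wpM2l// addr_ge0// ltW.
  lra.
exists (V 0 / l2) => n; rewrite ler_pdivlMr// mulrC.
apply: (@le_trans _ _ (V 0 - V n)); last by rewrite gerBl.
elim: n => [|n IH]; first by rewrite big_ord0 mulr0 subrr.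
by rewrite big_ord_recr /= mulrDr; have := VS n; lra.
Qed.

End sequences.

(** * The trust-region algorithm *)

Lemma lipschitz_le (R : realType) (U V : normedModType R) (M : R) (A : set U)
    (f : U -> V) x y :
  M.-lipschitz_A f -> A x -> A y -> `|f x - f y| <= M * `|x - y|.
Proof. by move=> lf Ax Ay; exact: (lf (x, y) (conj Ax Ay)). Qed.

Lemma linear_subZ (R : realType) (V W : normedModType R) (f g : {linear V -> W})
  (a : R) w : (f \- g) (a *: w) = a *: (f \- g) w.
Proof. by rewrite /= (linearZ_LR f) (linearZ_LR g) scalerBr. Qed.

Section trust_region.
Context {R : realType} {X Y : hilbertType R}.
Context (f0 : X -> R) (f1 : X -> Y) (phi0 : X -> \bar R) (phi1 : Y -> R).
Context (p : tr_params R) (s : tr_run X Y).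
Context (SA : standing_assumptions f0 f1 phi0 phi1) (PO : tr_params_ok p).
Context (run : generated_by_algorithm f0 f1 phi0 phi1 p s).

Local Notation x_ := (iterate s).
Local Notation y_ := (trial s).
Local Notation D_ := (Defs.radius s).
Local Notation h_ := (h_k phi0 phi1 s).
Local Notation pred_ := (pred_k phi0 phi1 s).
Local Notation ared_ := (ared_k f0 f1 phi0 phi1 s).
Local Notation ratio_ := (Defs.ratio phi0 phi1 s).
Local Notation normB k := (opnorm (model_hess s k)).

Let real_objective x := f0 x + phi1 (f1 x) + fine (phi0 x).
Let real_model k x := quad_model s k x + phi1 (lin_model s k x) + fine (phi0 x).

Lemma objective_fin x : Defs.dom phi0 x ->
  objective f0 f1 phi0 phi1 x = (real_objective x)%:E.
Proof.
by move=> dx; rewrite /objective (dom_fineK (phi0_proper SA) dx) -EFinD.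
Qed.

Lemma model_fin k x : Defs.dom phi0 x ->
  model phi0 phi1 s k x = (real_model k x)%:E.
Proof.
move=> dx; rewrite /model /nonsmooth_model (dom_fineK (phi0_proper SA) dx).
by rewrite -!EFinD addrA.
Qed.

Lemma stationarity_ge0 k t : 0 < t -> 0 <= stationarity phi0 phi1 s k t.
Proof. by move=> t0; rewrite /stationarity mulr_ge0// invr_ge0 ltW. Qed.

Lemma h_ge0 k : 0 <= h_ k.
Proof. exact: stationarity_ge0 (prox_step_gt0 run k). Qed.

Lemma radius_gt0 k : 0 < D_ k.
Proof.
have [g10 g12 g21 g31] := gamma_ok PO.
elim: k => [|k IH]; first exact: initial_radius run.
have [r1|r1] := ltP (ratio_ k) (eta1 p).
  have [_ /andP[h _]] := step_rejected run r1.
  by apply: lt_le_trans h; rewrite mulr_gt0.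
have [r2|r2] := ltP (ratio_ k) (eta2 p).
  have /andP[h _] := radius_successful run (introT andP (conj r1 r2)).
  by apply: lt_le_trans h; rewrite mulr_gt0// (lt_le_trans g10).
have /andP[h _] := radius_very_successful run r2; exact: lt_le_trans h.
Qed.

Lemma radius_shrink k : gamma1 p * D_ k <= D_ k.+1.
Proof.
have [g10 g12 g21 g31] := gamma_ok PO; have D0 := radius_gt0 k.
have [r1|r1] := ltP (ratio_ k) (eta1 p).
  by have [_ /andP[]] := step_rejected run r1.
have [r2|r2] := ltP (ratio_ k) (eta2 p).
  have /andP[h _] := radius_successful run (introT andP (conj r1 r2)).
  by apply: le_trans h; rewrite ler_pM2r.
have /andP[h _] := radius_very_successful run r2; apply: le_trans h.
by rewrite ger_pMl// (le_trans g12)// ltW.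
Qed.

Lemma decrease_ge0 k :
  0 <= kfcd p * h_ k * Num.min (h_ k / (1 + normB k)) (D_ k).
Proof.
have [[_ kf _] _] := kappa_ok PO.
have B0 : 0 < 1 + normB k by rewrite ltr_wpDr// opnorm_ge0.
have D0 := radius_gt0 k.
apply: mulr_ge0; first by rewrite mulr_ge0 ?h_ge0// ltW.
by rewrite le_min (ltW D0) divr_ge0 ?h_ge0 ?ltW.
Qed.

(** If the trial point were outside the domain, the decrease of the model would
be [-oo]. *)
Lemma trial_dom k : Defs.dom phi0 (x_ k) -> Defs.dom phi0 (y_ k).
Proof.
move=> dx; have := sufficient_decrease run k; rewrite (model_fin k dx).
have := phi0_proper SA; case=> pN _; have := pN (y_ k).
rewrite /Defs.dom /= /model /nonsmooth_model.
by case: (phi0 (y_ k)) => //= r _ _; rewrite ltry.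
Qed.

Lemma iterate_dom k : Defs.dom phi0 (x_ k).
Proof.
elim: k => [|k IH]; first exact: initial_iterate run.
have [r1|r1] := ltP (ratio_ k) (eta1 p).
  by have [-> _] := step_rejected run r1.
by rewrite (step_accepted run r1); exact: trial_dom.
Qed.

Lemma predE k : pred_ k = real_model k (x_ k) - real_model k (y_ k).
Proof.
rewrite /pred_k (model_fin k (iterate_dom k)).
by rewrite (model_fin k (trial_dom (iterate_dom k))).
Qed.

Lemma aredE k : ared_ k = real_objective (x_ k) - real_objective (y_ k).
Proof.
rewrite /ared_k (objective_fin (iterate_dom k)).
by rewrite (objective_fin (trial_dom (iterate_dom k))).
Qed.

Lemma pred_ge k :
  kfcd p * h_ k * Num.min (h_ k / (1 + normB k)) (D_ k) <= pred_ k.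
Proof.
have := sufficient_decrease run k; rewrite predE.
rewrite (model_fin k (iterate_dom k)) (model_fin k (trial_dom (iterate_dom k))).
by rewrite -EFinB lee_fin.
Qed.

Lemma pred_gt0 k : 0 < pred_ k.
Proof.
rewrite lt_def (pred_neq0 run)/=.
exact: le_trans (decrease_ge0 k) (pred_ge k).
Qed.

(** Up to errors quadratic in the step, [f0] and [f1] equal their first-order
expansions, and [g_k], [b_k], [A_k] are accurate to the order that makes their
contributions quadratic in the radius; only the curvature term brings in
[|B_k|]. *)
Lemma ared_pred_close : exists2 C : R, 0 < C &
  forall k, `|ared_ k - pred_ k| <= C * (1 + normB k) * D_ k ^+ 2.
Proof.
have [U [M [oU dU M0 dfU lU]]] := f0_smooth SA.
have [V [N [oV dV N0 dfV lV]]] := f1_smooth SA.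
have [L L0 lip] := phi1_lipschitz SA.
have [[kr0 _ kg0] [kv0 kj0 _]] := kappa_ok PO.
set kr := krad p in kr0; set kg := kgrad p in kg0; set kv := kval p in kv0.
set kj := kjac p in kj0.
pose C1 := M * kr ^+ 2 + kg * kr + L * (kv + (kj * kr + kv + N * kr ^+ 2)).
exists (C1 + kr ^+ 2) => [|k].
  rewrite ltr_pwDr ?exprn_gt0//.
  by rewrite !(addr_ge0, mulr_ge0)// ?exprn_ge0 ?ltW.
have dx := iterate_dom k; have dy := trial_dom dx.
have B0 : 0 <= normB k by exact: opnorm_ge0.
have D0 := ltW (radius_gt0 k).
set D := D_ k in D0 *; set x := x_ k in dx *; set y := y_ k in dy *.
pose v := y - x; have yE : y = x + v by rewrite /v addrCA subrr addr0.
have vD : `|v| <= kr * D by exact: trial_radius run k.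
have v2 : `|v| ^+ 2 <= kr ^+ 2 * D ^+ 2.
  by rewrite -exprMn lerXn2r// nnegrE// mulr_ge0// ltW.
have dseg t : 0 <= t <= 1 -> Defs.dom phi0 (x + t *: v).
  move=> t01; have -> : x + t *: v = t *: y + (1 - t) *: x.
    by rewrite /v scalerBr scalerBl scale1r addrCA.
  by have [] := fine_convex (phi0_proper SA) (phi0_convex SA) dy dx t01.
have tv t : 0 <= t <= 1 -> `|x + t *: v - x| <= `|v|.
  move=> /andP[t0 t1]; rewrite addrAC subrr add0r normrZ ger0_norm//.
  by rewrite ler_piMl.
have xU := dU _ dx; have xV := dV _ dx.
have R0 : `|f0 y - f0 x - inner (grad f0 x) v| <= M * kr ^+ 2 * D ^+ 2.
  rewrite yE -(grad_spec v (dfU _ xU)); apply: remainder_le => t t01.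
    by apply/dfU/dU/dseg.
  have zU := dU _ (dseg _ t01).
  rewrite (grad_spec _ (dfU _ zU)) (grad_spec _ (dfU _ xU)) -innerBl.
  apply: le_trans (norm_inner _ _) _; rewrite -mulrA.
  apply: le_trans (ler_wpM2r (normr_ge0 v) (lipschitz_le lU zU xU)) _.
  rewrite -mulrA ler_pM2l//; apply: le_trans v2.
  by rewrite expr2 ler_wpM2r// tv.
have R1 : `|f1 y - f1 x - 'd f1 x v| <= N * kr ^+ 2 * D ^+ 2.
  rewrite yE; apply: vector_remainder_le => t t01.
    by apply/dfV/dV/dseg.
  have zV := dV _ (dseg _ t01).
  have := @opnorm_le _ _ _ ('d f1 (x + t *: v) \- 'd f1 x) v.
  move=> /(_ (bounded_fun_normB (diff_bounded (dfV _ zV)) (diff_bounded (dfV _ xV)))) h.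
  apply: le_trans (h _) _; first exact: linear_subZ.
  apply: le_trans (ler_wpM2r (normr_ge0 v) (lV _ _ zV xV)) _.
  rewrite -[leLHS]mulrA -[leRHS]mulrA ler_pM2l//; apply: le_trans v2.
  by rewrite expr2 ler_wpM2r// tv.
have G : `|inner (model_grad s k - grad f0 x) v| <= kg * kr * D ^+ 2.
  apply: le_trans (norm_inner _ _) _.
  rewrite expr2 mulrACA; apply: ler_pM => //.
  apply: le_trans (model_grad_accuracy run k) _.
  by rewrite ler_pM2l// ge_min lexx orbT.
have Q : `|2^-1 * inner (model_hess s k v) v| <= kr ^+ 2 * normB k * D ^+ 2.
  rewrite normrM; apply: (@le_trans _ _ (1 * (normB k * `|v| * `|v|))).
    apply: ler_pM => //; first by rewrite ger0_norm; lra.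
    apply: le_trans (norm_inner _ _) _; apply: ler_wpM2r => //.
    by apply: opnorm_le; [exact: model_hess_bounded run k|exact: linearZ_LR].
  by rewrite mul1r -mulrA -expr2 [kr ^+ 2 * _]mulrC -mulrA ler_wpM2l.
have b1 : `|f1 x - model_val s k| <= kv * D ^+ 2.
  rewrite distrC; apply: le_trans (model_val_accuracy run k) _.
  by rewrite ler_pM2l// ge_min lexx orbT.
have A1 : `|model_jac s k v - 'd f1 x v| <= kj * kr * D ^+ 2.
  have := @opnorm_le _ _ _ (model_jac s k \- 'd f1 x) v.
  move=> /(_ (bounded_fun_normB (model_jac_bounded run k) (diff_bounded (dfV _ xV)))) h.
  apply: le_trans (h _) _; first exact: linear_subZ.
  rewrite expr2 mulrACA; apply: ler_pM => //; first exact: opnorm_ge0.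
  apply: le_trans (model_jac_accuracy run k) _.
  by rewrite ler_pM2l// ge_min lexx orbT.
have P0 : `|phi1 (f1 x) - phi1 (model_val s k)| <= L * (kv * D ^+ 2).
  by apply: le_trans (lipschitz_le lip I I) _; rewrite ler_pM2l.
have P1 : `|phi1 (model_jac s k v + model_val s k) - phi1 (f1 y)| <=
    L * ((kj * kr + kv + N * kr ^+ 2) * D ^+ 2).
  apply: le_trans (lipschitz_le lip I I) _; rewrite ler_pM2l//.
  have -> : model_jac s k v + model_val s k - f1 y =
      (model_jac s k v - 'd f1 x v) - (f1 x - model_val s k)
      - (f1 y - f1 x - 'd f1 x v).
    rewrite !opprB !addrA [RHS](ACl (1*3*7*(2*5)*(4*6)))/=.
    by rewrite !addNr !addr0.
  apply: le_trans (ler_normB _ _) _; rewrite !mulrDl; apply: lerD => //.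
  by apply: le_trans (ler_normB _ _) _; apply: lerD.
have -> : ared_ k - pred_ k =
    - (f0 y - f0 x - inner (grad f0 x) v) + inner (model_grad s k - grad f0 x) v
    + 2^-1 * inner (model_hess s k v) v
    + (phi1 (f1 x) - phi1 (model_val s k))
    + (phi1 (model_jac s k v + model_val s k) - phi1 (f1 y)).
  rewrite aredE predE /real_objective /real_model /quad_model /lin_model -/x -/y -/v.
  rewrite subrr !linear0 add0r innerBl.
  have i0 w : inner w (0 : X) = 0 by rewrite -(scale0r 0) innerZr mul0r.
  by rewrite !i0; ring.
have -> : (C1 + kr ^+ 2) * (1 + normB k) * D ^+ 2 =
  M * kr ^+ 2 * D ^+ 2 + kg * kr * D ^+ 2 + kr ^+ 2 * normB k * D ^+ 2 +
  L * (kv * D ^+ 2) + L * ((kj * kr + kv + N * kr ^+ 2) * D ^+ 2) +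
  (kr ^+ 2 + C1 * normB k) * D ^+ 2.
  by rewrite /C1; ring.
have rest : 0 <= (kr ^+ 2 + C1 * normB k) * D ^+ 2.
  rewrite mulr_ge0 ?exprn_ge0// addr_ge0 ?exprn_ge0 ?(ltW kr0)// mulr_ge0//.
  by rewrite !(addr_ge0, mulr_ge0)// ?exprn_ge0 ?ltW.
apply: le_trans (_ : _ <= _) (ler_wpDr rest (lexx _)).
do 4 (apply: le_trans (ler_normD _ _) _; apply: lerD => //).
by rewrite normrN.
Qed.

(** As [zeta > 1], the tolerance is of higher order than
[eta * min (pred_k, zeta_k)], which tends to 0 because [zeta_k] does. *)
Lemma ared_cred_close : exists K, forall k, (K <= k)%N ->
  `|ared_ k - cred s k| <= Defs.eta p * pred_ k.
Proof.
have [_ [_ _ ko0]] := kappa_ok PO; have z1 := zeta_ok PO.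
have /andP[e0] := eta_ok PO; rewrite lt_min => /andP[e1 e2].
have e_le1 : Defs.eta p <= 1.
  by have [? /andP[? ?]] := eta12_ok PO; lra.
have z0 : 0 < zeta p - 1 by rewrite subr_gt0.
(* For 0 <= r <= d one has kobj * r ^ zeta <= r. *)
pose d := (kobj p)^-1 `^ (zeta p - 1)^-1.
have d0 : 0 < d by rewrite powR_gt0// invr_gt0.
have [K _ Kd] := cvgr_lt _ (obj_tol_cvg0 run) _ d0.
exists K => k Kk; apply: le_trans (cred_accuracy run k) _.
set m := Num.min _ _.
have m0 : 0 < m by rewrite lt_min pred_gt0 (obj_tol_gt0 run).
have em0 : 0 < Defs.eta p * m by rewrite mulr_gt0.
have emd : Defs.eta p * m <= d.
  apply: (@le_trans _ _ m); first by rewrite ger_pMl.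
  by apply: ltW; apply: le_lt_trans (Kd k Kk); rewrite /m ge_min lexx orbT.
have small : (Defs.eta p * m) `^ (zeta p - 1) <= (kobj p)^-1.
  apply: (@le_trans _ _ (d `^ (zeta p - 1))).
    by apply: ge0_ler_powR; rewrite ?nnegrE // ltW.
  by rewrite /d -powRrM mulVf ?gt_eqF// powRr1// invr_ge0 ltW.
rewrite -(mulr_powRB1 (ltW em0) (lt_trans ltr01 z1)).
apply: (@le_trans _ _ (Defs.eta p * m)); last by rewrite ler_pM2l// ge_min lexx.
rewrite mulrCA -[leRHS]mulr1 ler_pM2l//.
by rewrite -ler_pdivlMl ?mulr1.
Qed.

Lemma real_objective_ge : exists lb, forall k, lb <= real_objective (x_ k).
Proof.
have [lb lbP] := objective_lbound SA; exists lb => k.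
by rewrite -lee_fin -(objective_fin (iterate_dom k)).
Qed.

Lemma radius_le k : D_ k.+1 <= gamma3 p * D_ k.
Proof.
have [g10 g12 g21 g31] := gamma_ok PO; have D0 := radius_gt0 k.
have [r1|r1] := ltP (ratio_ k) (eta1 p).
  have [_ /andP[_ h]] := step_rejected run r1.
  by apply: le_trans h _; rewrite ler_pM2r// (le_trans _ g31)// ltW.
have [r2|r2] := ltP (ratio_ k) (eta2 p).
  have /andP[_ h] := radius_successful run (introT andP (conj r1 r2)).
  by apply: le_trans h _; rewrite ler_peMl// ltW.
by have /andP[] := radius_very_successful run r2.
Qed.

(** Here [h_k] is bounded away from 0 from index [K] on, which is to be
contradicted. *)
Section away_from_stationarity.
Context (e C : R) (K : nat).
Context (e0 : 0 < e) (C0 : 0 < C).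
Context (he : forall k, (K <= k)%N -> e <= h_ k).
Context (apC : forall k, `|ared_ k - pred_ k| <= C * (1 + normB k) * D_ k ^+ 2).
Context (credK : forall k, (K <= k)%N ->
  `|ared_ k - cred s k| <= Defs.eta p * pred_ k).

Let B1_gt0 k : 0 < 1 + normB k.
Proof. by rewrite ltr_wpDr// opnorm_ge0. Qed.

Let pred_lb k : (K <= k)%N ->
  kfcd p * e * Num.min (e / (1 + normB k)) (D_ k) <= pred_ k.
Proof.
move=> Kk; have [[_ kf _] _] := kappa_ok PO.
have ek := he Kk; apply: le_trans (pred_ge k); apply: ler_pM.
- by rewrite mulr_ge0// ltW.
- by rewrite le_min (ltW (radius_gt0 k)) divr_ge0// ltW.
- by rewrite ler_pM2l.
- by rewrite le_min !ge_min ler_pM2r ?invr_gt0// ek lexx orbT.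
Qed.

(** For [(1 + |B_k|) * Delta_k <= c1], the first argument of the minimum makes
[Delta_k] the smaller quantity in the bound on [pred_k], and the second one
keeps [|ared_k - pred_k|] below the fraction [1 - eta2 - eta] of [pred_k]. *)
Let c1 := Num.min e ((1 - eta2 p - Defs.eta p) * kfcd p * e / C).

Let c1_gt0 : 0 < c1.
Proof.
have [[_ kf _] _] := kappa_ok PO.
have /andP[_] := eta_ok PO; rewrite lt_min => /andP[_ h].
by rewrite lt_min e0 divr_gt0// !mulr_gt0// subr_gt0.
Qed.

Let very_successful k : (K <= k)%N -> (1 + normB k) * D_ k <= c1 ->
  eta2 p <= ratio_ k.
Proof.
move=> Kk small; have P0 := pred_gt0 k; have D0 := radius_gt0 k.
rewrite /Defs.ratio ler_pdivlMr//.
have := pred_lb Kk; have -> : Num.min (e / (1 + normB k)) (D_ k) = D_ k.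
  apply/min_idPr; rewrite ler_pdivlMr// mulrC (le_trans small)//.
  by rewrite /c1 ge_min lexx.
move=> pl; have := apC k; have := credK Kk.
have ap : C * (1 + normB k) * D_ k ^+ 2 <= (1 - eta2 p - Defs.eta p) * pred_ k.
  apply: (@le_trans _ _ ((1 - eta2 p - Defs.eta p) * (kfcd p * e * D_ k))).
    rewrite expr2 !mulrA ler_pM2r// -mulrA mulrC -ler_pdivlMr//.
    by apply: le_trans small _; rewrite /c1 ge_min lexx orbT.
  rewrite ler_wpM2l//.
  by have /andP[_] := eta_ok PO; rewrite lt_min => /andP[_ h]; rewrite ltW// subr_gt0.
rewrite !ler_norml => /andP[? ?] /andP[? ?]; lra.
Qed.

Let a_ k : R := 1 + \big[Num.max/0%R]_(j < k.+1) normB j.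

Let a_ge k : 1 + normB k <= a_ k.
Proof. by rewrite lerD2l (le_bigmax _ _ (@ord_max k)). Qed.

Let a_gt0 k : 0 < a_ k.
Proof. exact: lt_le_trans (B1_gt0 k) (a_ge k). Qed.

Let a_mono k : a_ k <= a_ k.+1.
Proof.
by rewrite lerD2l (le_bigmax_ord predT (fun j => normB j)).
Qed.

(** A radius below [c1 / a_k] does not shrink, and one step shrinks it at most by
the factor [gamma1]; so from index [K] on it stays above [c / a_k], the second argument of
the minimum covering its initial value. *)
Let c := Num.min (gamma1 p * c1) (D_ K * a_ K).

Let c_gt0 : 0 < c.
Proof.
have [g10 _ _ _] := gamma_ok PO.
by rewrite lt_min !mulr_gt0// radius_gt0.
Qed.

Let radius_next k : (K <= k)%N -> c * (a_ k)^-1 <= D_ k -> c * (a_ k)^-1 <= D_ k.+1.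
Proof.
move=> Kk h; have [g10 _ _ _] := gamma_ok PO.
have [small|big] := leP ((1 + normB k) * D_ k) c1.
  have /andP[? _] := radius_very_successful run (very_successful Kk small).
  exact: le_trans h _.
apply: le_trans (radius_shrink k).
apply: (@le_trans _ _ (gamma1 p * c1 * (a_ k)^-1)).
  by rewrite ler_pM2r ?invr_gt0// /c ge_min lexx.
rewrite -mulrA ler_pM2l// ler_pdivrMr// mulrC.
apply: le_trans (ltW big) _; rewrite ler_pM2r// ?radius_gt0//.
Qed.

Let radius_lb i : c * (a_ (K + i))^-1 <= D_ (K + i).
Proof.
elim: i => [|i IH].
  by rewrite addn0 ler_pdivrMr// /c ge_min lexx orbT.
rewrite addnS; apply: le_trans (radius_next (leq_addr _ _) IH).
by rewrite ler_pM2l// lef_pV2 ?posrE.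
Qed.

Lemma curvature_series_converges : (\sum_(0 <= k <oo)
  ((1 + \big[Num.max/0%R]_(j < k.+1) normB j)^-1)%:E < +oo)%E.
Proof.
have [g10 g12 g21 g31] := gamma_ok PO.
have [[_ kf _] _] := kappa_ok PO.
have [lb lbP] := real_objective_ge.
have /andP[_] := eta_ok PO; rewrite lt_min => /andP[e1 _].
have m0 : 0 < Num.min e c by rewrite lt_min e0.
(* An accepted step decreases the objective by at least w / a_k. *)
pose w := (eta1 p - Defs.eta p) * (kfcd p * e * Num.min e c).
have w0 : 0 < w by rewrite !mulr_gt0// subr_gt0.
have [||||||||||B HB] := @summable_of_radius_dynamics R
    (fun i => (a_ (K + i))^-1) (fun i => D_ (K + i))
    (fun i => real_objective (x_ (K + i)) - lb) c (gamma2 p) (gamma3 p) w^-1 => //.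
- by rewrite g21 andbT (lt_le_trans g10).
- by rewrite invr_ge0 ltW.
- by move=> i; rewrite invr_gt0.
- by move=> i; rewrite addnS lef_pV2 ?posrE.
- by move=> i; rewrite addnS; apply: radius_next; rewrite ?leq_addr.
- by move=> i; rewrite subr_ge0.
- move=> i; rewrite addnS; set k := (K + i)%N.
  have Kk : (K <= k)%N by rewrite leq_addr.
  have [r1|r1] := ltP (ratio_ k) (eta1 p).
    by left; have [-> /andP[_ ->]] := step_rejected run r1.
  right; split; first exact: radius_le.
  rewrite ler_pdivlMl// (step_accepted run r1).
  have -> : real_objective (x_ k) - lb - (real_objective (y_ k) - lb) = ared_ k.
    by rewrite aredE; ring.
  have pw : kfcd p * e * Num.min e c * (a_ k)^-1 <= pred_ k.
    apply: le_trans (pred_lb Kk); rewrite -mulrA ler_pM2l ?mulr_gt0//.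
    rewrite le_min; apply/andP; split.
      apply: ler_pM; [exact: ltW|by rewrite invr_ge0 ltW|by rewrite ge_min lexx|].
      by rewrite lef_pV2 ?posrE.
    apply: le_trans (radius_lb i); rewrite ler_pM2r ?invr_gt0//.
    by rewrite ge_min lexx orbT.
  have cr : eta1 p * pred_ k <= cred s k by rewrite -ler_pdivlMr// pred_gt0.
  have := credK Kk; rewrite ler_norml => /andP[h _].
  apply: (@le_trans _ _ ((eta1 p - Defs.eta p) * pred_ k)); last by lra.
  by rewrite /w -[leLHS]mulrA ler_pM2l// subr_gt0.
apply: (nneseries_lt_pinfty (K := K) (B := B)) => [k|]; last exact: HB.
by rewrite invr_ge0 ltW// a_gt0.
Qed.

End away_from_stationarity.

End trust_region.

(** * Limits of the stationarity measures *)

Lemma lipschitz_continuous (R : realType) (U V : normedModType R) (f : U -> V) (L : R) :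
  0 < L -> L.-lipschitz f -> continuous f.
Proof.
move=> L0 lf x; apply/cvgrPdist_lt => e e0.
have : \forall y \near x, `|x - y| < e / L.
  by apply: (@cvgr_dist_lt _ _ _ _ _ id) => //; rewrite divr_gt0.
apply: filterS => y xy; apply: le_lt_trans (lipschitz_le lf I I) _.
by rewrite mulrC -ltr_pdivlMr.
Qed.

Lemma convex_function_le (R : realType) (Y : hilbertType R) (f : Y -> R)
    (x y : Y) (t : R) :
  convex_function [set: Y] f -> 0 <= t <= 1 ->
  f (t *: x + (1 - t) *: y) <= t * f x + (1 - t) * f y.
Proof.
move=> cf /andP[t0 t1].
by have := cf (Itv01 t0 t1) x y (in_setT _) (in_setT _).
Qed.

Section nonsmooth_model.
Context {R : realType} {X Y : hilbertType R}.
Context (f0 : X -> R) (f1 : X -> Y) (phi0 : X -> \bar R) (phi1 : Y -> R).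
Context (p : tr_params R) (s : tr_run X Y).
Context (SA : standing_assumptions f0 f1 phi0 phi1).
Context (run : generated_by_algorithm f0 f1 phi0 phi1 p s).

Lemma nonsmooth_model_proper k : Defs.proper (nonsmooth_model phi0 phi1 s k).
Proof. exact: (proper_addl _ (phi0_proper SA)). Qed.

Lemma nonsmooth_model_closed k : closed_function (nonsmooth_model phi0 phi1 s k).
Proof.
apply: closed_function_addl (phi0_closed SA) => x.
have [L L0 lip] := phi1_lipschitz SA.
have cA : continuous (model_jac s k).
  by apply: bounded_linear_continuous; apply/bounded_funP; exact: model_jac_bounded run k.
apply: (@continuous_comp _ _ _ (lin_model s k) (phi1 : Y -> R^o)); last first.
  exact: (lipschitz_continuous L0 lip).
apply: cvgD; last exact: cvg_cst.
apply: (@continuous_comp _ _ _ (fun x => x - iterate s k) (model_jac s k)); last exact: cA.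
by apply: cvgB; [exact: cvg_id|exact: cvg_cst].
Qed.

Lemma nonsmooth_model_convex k : convex_efunction (nonsmooth_model phi0 phi1 s k).
Proof.
apply: convex_addl (phi0_convex SA); last exact: (phi0_proper SA).1.
move=> x y t t01; apply: le_trans (convex_function_le _ _ (phi1_convex SA) t01).
rewrite le_eqVlt; apply/orP; left; apply/eqP; congr phi1.
rewrite /lin_model; set a := iterate s k; set b := model_val s k.
have -> : t *: x + (1 - t) *: y - a = t *: (x - a) + (1 - t) *: (y - a).
  by rewrite !scalerBr addrACA -opprD -scalerDl (addrC t) subrK scale1r.
rewrite linearD !linearZ_LR !scalerDr addrACA -scalerDl.
by rewrite (addrC t) subrK scale1r.
Qed.

Lemma stationarity_le k t : 0 < t ->
  stationarity phi0 phi1 s k t <=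
    Num.max 1 (prox_step s k / t) * h_k phi0 phi1 s k.
Proof.
move=> t0; have clm := @nonsmooth_model_closed k.
exact: (prox_step_le _ _ (nonsmooth_model_proper k) clm
  (@nonsmooth_model_convex k) t0 (prox_step_gt0 run k)).
Qed.

End nonsmooth_model.

Theorem theorem8 (R : realType) (X Y : hilbertType R)
    (f0 : X -> R) (f1 : X -> Y) (phi0 : X -> \bar R) (phi1 : Y -> R)
    (p : tr_params R) (s : tr_run X Y) :
  standing_assumptions f0 f1 phi0 phi1 ->
  tr_params_ok p ->
  generated_by_algorithm f0 f1 phi0 phi1 p s ->
  (\sum_(0 <= k <oo)
     ((1 + \big[Num.max/0%R]_(j < k.+1) opnorm (model_hess s j))^-1)%:E
   = +oo)%E ->
  limn_einf (fun k => (h_k phi0 phi1 s k)%:E) = 0%E /\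
  ((exists2 tmax : R, 0 < tmax & forall k, prox_step s k <= tmax) ->
   forall t : R, 0 < t ->
     limn_einf (fun k => (stationarity phi0 phi1 s k t)%:E) = 0%E).
Proof.
move=> SA PO run divergent.
have small e : 0 < e -> forall N, exists2 n, (N <= n)%N & h_k phi0 phi1 s n < e.
  move=> e0 N; apply: contrapT => none.
  have he n : (N <= n)%N -> e <= h_k phi0 phi1 s n.
    by move=> Nn; rewrite leNgt; apply/negP => hn; apply: none; exists n.
  have [C C0 apC] := ared_pred_close SA PO run.
  have [K credK] := ared_cred_close SA PO run.
  have [] : ~ (+oo < +oo :> \bar R)%E by rewrite ltxx.
  rewrite -{1}divergent.
  apply: (@curvature_series_converges _ _ _ _ _ _ _ p s SA PO run e C (maxn N K)) => //.
    by move=> k; rewrite geq_max => /andP[? _]; exact: he.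
  by move=> k; rewrite geq_max => /andP[_ ?]; exact: credK.
split; first by apply: limn_einf_eq0 => // n; exact: h_ge0 run n.
move=> [tmax tmax0 tle] t t0; apply: limn_einf_eq0 => [n|e e0 N].
  exact: stationarity_ge0.
pose M := Num.max 1 (tmax / t).
have M0 : 0 < M by rewrite lt_max ltr01.
have [n Nn hn] := small (e / M) (divr_gt0 e0 M0) N.
exists n => //; apply: le_lt_trans (stationarity_le SA run n t0) _.
apply: (@le_lt_trans _ _ (M * h_k phi0 phi1 s n)).
  rewrite ler_wpM2r ?(h_ge0 run)// ge_max !le_max lexx/= ler_pM2r ?invr_gt0//.
  by rewrite tle orbT.
by rewrite mulrC -ltr_pdivlMr.
Qed.
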